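(* Let $R$ be a diametral quadrilateral in the euclidean, hyperbolic or elliptic plane, with vertices $A,B,C,D$ (in this cyclic order) and right angles at $B$ and $D$. Let $A_*, C_*$ be the orthogonal projections of the points $A, C$, respectively, onto the diagonal line $BD$. Then a midpoint of the segment $\overline{BD}$ is also a midpoint of the segment $\overline{A_*C_*}$; that is, if $M$ is a midpoint of $\overline{BD}$, then $M$ is a midpoint of $\overline{A_*C_*}$.
   Context: A quadrilateral in the euclidean, hyperbolic or elliptic plane has four distinct vertices, no three of them collinear. It is called diametral if it has two right angles located at opposite vertices. Here this means that line $AB$ is perpendicular to line $BC$ and line $AD$ is perpendicular to line $DC$. The elliptic plane is the real projective plane $\mathbb{RP}^2$ with the geometry determined by an imaginary conic $\Phi_\infty$ (non-degenerate, with an equation with real coefficients, without real points). Two lines are perpendicular if each contains the pole of the other with respect to $\Phi_\infty$. The orthogonal projection of a point $P$ (not the pole of $p$) onto a line $p$ is the intersection of $p$ with the perpendicular to $p$ through $P$. Midpoints: in the euclidean and hyperbolic planes a segment is determined by its endpoints and has a unique midpoint. In the elliptic plane the midpoints of $\overline{PQ}$, for distinct points $P,Q$, are the two points of the line $PQ$ which are equidistant from $P$ and $Q$. For a degenerate segment ($P=Q$ on a given line $p$), the midpoint is $P$ itself in the euclidean and hyperbolic cases. In the elliptic case the midpoints are $P$ and the point of $p$ conjugate to $P$, i.e. the intersection of $p$ with the polar of $P$ with respect to $\Phi_\infty$; when $A_*=C_*$ this is applied on the line $p=BD$. *)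

(* Defs.v *)
From HB Require Import structures.
From mathcomp Require Import all_boot all_order all_algebra.
From mathcomp Require Import sesquilinear.
From mathcomp Require Import boolp reals exp trigo.
Set Implicit Arguments.
Unset Strict Implicit.
Unset Printing Implicit Defensive.
Import Order.TTheory GRing.Theory Num.Theory.
Local Open Scope ring_scope.

Section Euclidean.
Variable R : realType.

Definition dotp (u v : 'rV[R]_2) : R := \sum_(i < 2) u 0 i * v 0 i.

Definition edist (P Q : 'rV[R]_2) : R := Num.sqrt (dotp (P - Q) (P - Q)).

(* The line through [eorigin] with direction [edir]. Several records describe
   the same set of points; lines are never compared for equality below. *)
Record eline := ELine {
  eorigin : 'rV[R]_2;
  edir : 'rV[R]_2;
  edir_neq0 : edir != 0 }.

Definition eon (P : 'rV[R]_2) (l : eline) : Prop :=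
  exists t : R, P = eorigin l + t *: edir l.

Definition eperp (l m : eline) : Prop := dotp (edir l) (edir m) = 0.

End Euclidean.

Section ProjectivePlane.
Variable R : realType.

(* The real projective plane: points and lines are the subspaces of R^3 of
   dimension 1 and 2, and incidence is inclusion. *)
Definition ppoint := {P : {vspace 'rV[R]_3} | \dim P == 1%N}.
Definition pline := {l : {vspace 'rV[R]_3} | \dim l == 2%N}.

Definition pon (P : ppoint) (l : pline) : Prop := (val P <= val l)%VS.

(* A conic is given by a nondegenerate symmetric bilinear form [phi] on R^3: it
   is the set of the points spanned by the [v] such that [phi v v = 0].  With
   respect to it, [orthov phi] maps a point to its polar and a line to its
   pole.  All the notions below are unchanged if [phi] is multiplied by a
   nonzero scalar. *)
Implicit Type phi : {symmetric 'rV[R]_3}.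

Definition on_conic phi (P : ppoint) : Prop :=
  {in val P, forall v, phi v v = 0}.

Definition pconjugate phi (P Q : ppoint) : Prop :=
  (val Q <= orthov phi (val P))%VS.

Definition is_pole phi (P : ppoint) (l : pline) : Prop :=
  val P = orthov phi (val l).

Definition pperp phi (l m : pline) : Prop :=
  (orthov phi (val l) <= val m)%VS /\ (orthov phi (val m) <= val l)%VS.

(* The tangents to the conic are the polars of its points; a point is interior
   if it lies on no tangent. *)
Definition interior_point phi (P : ppoint) : Prop :=
  forall T : ppoint, on_conic phi T -> ~ pconjugate phi T P.

(* With [p] and [q] spanning [P] and [Q], this is
   |phi(p,q)| / sqrt (phi(p,p) phi(q,q)): the cosine of the distance in the
   elliptic plane and its hyperbolic cosine in the hyperbolic plane. It does not
   depend on the choice of [p] and [q]. *)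
Definition ck_cos phi (P Q : ppoint) : R :=
  let p := vpick (val P) in let q := vpick (val Q) in
  `|phi p q| / Num.sqrt (phi p p * phi q q).

Definition arcosh (x : R) : R := ln (x + Num.sqrt (x ^+ 2 - 1)).

Record real_conic := RealConic {
  real_form :> {symmetric 'rV[R]_3};
  real_nondeg : nondegenerate real_form;
  real_points : exists P : ppoint, on_conic real_form P }.

Record imaginary_conic := ImaginaryConic {
  imag_form :> {symmetric 'rV[R]_3};
  imag_nondeg : nondegenerate imag_form;
  imag_no_points : ~ exists P : ppoint, on_conic imag_form P }.

End ProjectivePlane.

(* The hyperbolic plane is the Beltrami-Klein model in the interior of a conic
   with real points. *)
Inductive plane (R : realType) : Type :=
  | Euclidean
  | Hyperbolic of real_conic R
  | Elliptic of imaginary_conic R.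

Section Geometry.
Variables (R : realType) (G : plane R).

Definition point_of : Type :=
  match G with
  | Euclidean => 'rV[R]_2
  | Hyperbolic phi => {P : ppoint R | `[< interior_point phi P >]}
  | Elliptic _ => ppoint R
  end.

(* A hyperbolic line is the trace, on the interior of the conic, of a
   projective line.  Projective lines with an empty trace are harmless:
   every line occurring below is required to pass through a
   point of the plane. *)
Definition line_of : Type :=
  match G with
  | Euclidean => eline R
  | Hyperbolic _ => pline R
  | Elliptic _ => pline R
  end.

End Geometry.

Definition incident (R : realType) (G : plane R) : point_of G -> line_of G -> Prop :=
  match G with
  | Euclidean => fun P l => eon P l
  | Hyperbolic _ => fun P l => pon (val P) l
  | Elliptic _ => fun P l => pon P l
  end.

Definition perp (R : realType) (G : plane R) : line_of G -> line_of G -> Prop :=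
  match G with
  | Euclidean => fun l m => eperp l m
  | Hyperbolic phi => fun l m => pperp phi l m
  | Elliptic phi => fun l m => pperp phi l m
  end.

Definition dist (R : realType) (G : plane R) : point_of G -> point_of G -> R :=
  match G with
  | Euclidean => fun P Q => edist P Q
  | Hyperbolic phi => fun P Q => arcosh (ck_cos phi (val P) (val Q))
  | Elliptic phi => fun P Q => acos (ck_cos phi P Q)
  end.

(* In the Euclidean plane there are no poles, and in the hyperbolic plane poles
   of lines are not points of the plane. *)
Definition pole (R : realType) (G : plane R) : point_of G -> line_of G -> Prop :=
  match G with
  | Euclidean => fun _ _ => False
  | Hyperbolic _ => fun _ _ => False
  | Elliptic phi => fun P l => is_pole phi P l
  end.

(* [conjugate P M]: [M] lies on the polar of [P]; in the hyperbolic plane the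
   polar of a point does not meet the plane. *)
Definition conjugate (R : realType) (G : plane R) : point_of G -> point_of G -> Prop :=
  match G with
  | Euclidean => fun _ _ => False
  | Hyperbolic _ => fun _ _ => False
  | Elliptic phi => fun P M => pconjugate phi P M
  end.

Section Quadrilaterals.
Variables (R : realType) (G : plane R).
Implicit Types (A B C D P Q X M : point_of G) (l m p : line_of G).

Definition collinear P Q X : Prop :=
  exists l, [/\ incident P l, incident Q l & incident X l].

Definition quadrilateral A B C D : Prop :=
  [/\ [/\ A <> B, A <> C & A <> D], [/\ B <> C, B <> D & C <> D]
    & [/\ ~ collinear A B C, ~ collinear A B D, ~ collinear A C D
        & ~ collinear B C D]].

(* The lines PQ and QX are perpendicular. *)
Definition right_angle P Q X : Prop :=
  exists l m, [/\ incident P l, incident Q l, incident Q m, incident X m & perp l m].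

Definition diametral A B C D : Prop :=
  [/\ quadrilateral A B C D, right_angle A B C & right_angle A D C].

Definition orthogonal_projection P p X : Prop :=
  ~ pole P p /\ exists m, [/\ incident P m, perp p m, incident X p & incident X m].

(* The segment lies on the line [p], which matters only if [P = Q].  If
   [P <> Q], [p] is the line PQ; in the Euclidean and hyperbolic planes it has
   only one point equidistant from [P] and [Q], the midpoint. *)
Definition midpoint p P Q M : Prop :=
  [/\ incident P p, incident Q p, incident M p,
      P <> Q -> dist M P = dist M Q
    & P = Q -> M = P \/ conjugate P M].

End Quadrilaterals.

(* Main.v *)
(* In the euclidean plane, subtracting the scalar products of the right angles
   at B and D shows that the sum of the coordinates of A_* and C_* on BD equals
   that of B and D.

   In the other planes let f be the bilinear form of the absolute conic.  A right
   angle at B reads f(a,b) f(b,c) = f(b,b) f(a,c), and replacing a, c by the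
   projections a', c' changes the two sides by the same factor.  Normalise d so
   that f(d,d) = f(b,b) and f(m,d) = f(m,b).  Then u = b + d and v = b - d form an
   orthogonal basis of BD with m proportional to u, and the two right angles give
   a_1 c_2 = - a_2 c_1 for the coordinates of a', c' in this basis: the
   reflection of BD in M exchanges A_* and C_*. *)

Require Import Defs.
From mathcomp Require Import all_boot all_order all_algebra reals.
From mathcomp Require Import sesquilinear boolp exp trigo ring lra.
Set Implicit Arguments.
Unset Strict Implicit.
Unset Printing Implicit Defensive.
Import Order.TTheory GRing.Theory Num.Theory.
Local Open Scope ring_scope.

Local Notation vec P := (vpick (val P)).

(** * Scalar products in the euclidean plane *)

Section EuclideanLemmas.
Variable R : realType.
Implicit Types (u v w P Q : 'rV[R]_2) (l : eline R).

Lemma dotpC u v : dotp u v = dotp v u.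
Proof. by apply: eq_bigr => i _; rewrite mulrC. Qed.

Lemma dotpDl u v w : dotp (u + v) w = dotp u w + dotp v w.
Proof.
by rewrite /dotp -big_split; apply: eq_bigr => i _; rewrite mxE mulrDl.
Qed.

Lemma dotpZl k u v : dotp (k *: u) v = k * dotp u v.
Proof. by rewrite /dotp mulr_sumr; apply: eq_bigr => i _; rewrite mxE mulrA. Qed.

Lemma dotpDr u v w : dotp u (v + w) = dotp u v + dotp u w.
Proof. by rewrite !(dotpC u) dotpDl. Qed.

Lemma dotpZr k u v : dotp u (k *: v) = k * dotp u v.
Proof. by rewrite !(dotpC u) dotpZl. Qed.

Lemma dotp_ge0 u : 0 <= dotp u u.
Proof. by apply: sumr_ge0 => i _; rewrite -expr2 sqr_ge0. Qed.

Lemma dotp_gt0 u : u != 0 -> 0 < dotp u u.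
Proof.
move=> u0; rewrite lt_def dotp_ge0 andbT; apply: contraNneq u0.
rewrite /dotp => /eqP; rewrite psumr_eq0; last by move=> i _; rewrite -expr2 sqr_ge0.
move=> /allP h; apply/eqP/rowP => i; rewrite mxE.
by have /eqP/eqP := h i (mem_index_enum i); rewrite -expr2 sqrf_eq0 => /eqP.
Qed.

Lemma eon_sub P Q l : eon P l -> eon Q l -> exists t, P - Q = t *: edir l.
Proof.
move=> [s ->] [t ->]; exists (s - t).
by rewrite scalerBl opprD addrACA subrr add0r.
Qed.


End EuclideanLemmas.

(** Passes from a right angle at [b] between [a] and [c] to their projections [p] and [q]. The new
    constant [ac / (k * j)] does not involve [b], so both right angles will share it. *)
Lemma gram_rescale (F : fieldType) (k j ab bc bb ac pb bq : F) :
  k != 0 -> j != 0 -> ab = k * pb -> bc = j * bq ->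
  ab * bc = bb * ac -> pb * bq = bb * (ac / (k * j)).
Proof.
move=> k0 j0 -> -> e; apply: (mulfI (mulf_neq0 k0 j0)).
by rewrite mulrACA e; field; rewrite k0 j0.
Qed.

(** * Bilinear forms on R^3 and incidence in the projective plane *)

Section Form.
Variables (R : realType) (f : {symmetric 'rV[R]_3}).
Implicit Types (u v w : 'rV[R]_3) (P Q : ppoint R) (l : pline R).

Lemma formC u v : f u v = f v u.
Proof. by rewrite hermC expr0 mul1r. Qed.

Lemma formZl k u v : f (k *: u) v = k * f u v.
Proof. by rewrite linearZl_LR. Qed.

Lemma formZr k u v : f u (k *: v) = k * f u v.
Proof. by rewrite formC formZl formC. Qed.

Lemma formDl u v w : f (u + v) w = f u w + f v w.
Proof. exact: linearDl. Qed.

Lemma formDr u v w : f u (v + w) = f u v + f u w.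
Proof. exact: linearDr. Qed.

Definition formE := (formDl, formDr, formZl, formZr).

(** Each of the two linear conditions lowers the dimension 3 by at most one. *)
Lemma exists_orthogonal u v : exists w, [/\ w != 0, f w u = 0 & f w v = 0].
Proof.
have h1 := leq_dim_orthov1 f u fullv.
have h2 := leq_dim_orthov1 f v (fullv :&: orthov f <[u]>).
rewrite dimvf /dim /= in h1.
have h3 : (0 < \dim ((fullv :&: orthov f <[u]>) :&: orthov f <[v]>))%N.
  apply: leq_trans h2; have := h1; case: (\dim (fullv :&: _)) => [|[|]] //.
set W := (_ :&: orthov f <[v]>)%VS in h3.
exists (vpick W); split; first by rewrite vpick0 -dimv_eq0 -lt0n.
  have := memv_pick W; rewrite !memv_cap => /andP[/andP[_]].
  by rewrite mem_orthov1 => /eqP.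
by have := memv_pick W; rewrite !memv_cap => /andP[_]; rewrite mem_orthov1 => /eqP.
Qed.

Lemma ppointE P : val P = <[vec P]>%VS.
Proof.
apply/esym/eqP; rewrite eqEdim -memvE memv_pick dim_vline vpick0 -dimv_eq0.
by rewrite (eqP (valP P)).
Qed.

Lemma vec_neq0 P : vec P != 0.
Proof. by rewrite vpick0 -dimv_eq0 (eqP (valP P)). Qed.

Lemma ponE P l : pon P l <-> vec P \in val l.
Proof. by rewrite /pon ppointE -memvE -ppointE. Qed.

Lemma pconjugateE P Q : pconjugate f P Q <-> f (vec Q) (vec P) = 0.
Proof.
split=> [/orthovP|h]; first by apply; apply: memv_pick.
apply/orthovP => u v; rewrite (ppointE Q) (ppointE P).
by move=> /vlineP[s ->] /vlineP[t ->]; rewrite !formE h !mulr0.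
Qed.

Lemma ppoint_eq P Q k : vec P = k *: vec Q -> P = Q.
Proof.
move=> h; apply/val_inj/eqP; rewrite eqEdim (eqP (valP P)) (eqP (valP Q)) leqnn andbT.
by rewrite ppointE -memvE h ppointE memvZ ?memv_pick // -ppointE memv_pick.
Qed.

Lemma ppoint_of_vec v : v != 0 -> exists P, exists2 k, k != 0 & vec P = k *: v.
Proof.
move=> v0; have d1 : \dim <[v]> == 1%N by rewrite dim_vline v0.
exists (exist _ <[v]>%VS d1).
have /vlineP[k e] := memv_pick <[v]>.
exists k => //; apply/negP => /eqP k0.
by have := vpick0 <[v]>; rewrite e k0 scale0r eqxx -dimv_eq0 dim_vline v0.
Qed.

Lemma pline_span l u v w : u \in val l -> v \in val l -> u != 0 ->
  (forall k, v <> k *: u) -> w \in val l -> exists x y, w = x *: u + y *: v.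
Proof.
move=> ul vl u0 huv wl.
have v0 : v != 0 by apply/eqP => v0; apply: (huv 0); rewrite scale0r.
have uvl : (<[u]> + <[v]> <= val l)%VS by rewrite subv_add -!memvE ul vl.
have d : \dim (<[u]> + <[v]>)%VS = 2.
  rewrite dimv_disjoint_sum ?dim_vline ?u0 ?v0 //.
  apply/eqP; rewrite -subv0; apply/subvP => x; rewrite memv_cap => /andP[].
  move=> /vlineP[s ->] /vlineP[t e].
  have [t0|t0] := eqVneq t 0; first by rewrite e t0 scale0r mem0v.
  case: (huv (t^-1 * s)).
  by rewrite -scalerA e scalerA mulVf // scale1r.
have /eqP e : (<[u]> + <[v]>)%VS == val l.
  by rewrite eqEdim uvl d (eqP (valP l)).
move: wl; rewrite -e => /memv_addP[_ /vlineP[x ->] [_ /vlineP[y ->] ->]].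
by exists x, y.
Qed.

Lemma pline_span_points l P Q w : pon P l -> pon Q l -> P <> Q ->
  w \in val l -> exists x y, w = x *: vec P + y *: vec Q.
Proof.
move=> /ponE Pl /ponE Ql PQ; apply: pline_span Pl Ql (vec_neq0 P) _ => k h.
by apply: PQ; rewrite (ppoint_eq h).
Qed.

Lemma pline_pole l P Q : pon P l -> pon Q l -> P <> Q ->
  exists2 n, n != 0 & n \in orthov f (val l).
Proof.
move=> Pl Ql PQ; have [n [n0 nP nQ]] := exists_orthogonal (vec P) (vec Q).
exists n => //; apply/mem_orthovP => w wl.
have [x [y ->]] := pline_span_points Pl Ql PQ wl.
by rewrite !formE nP nQ !mulr0 addr0.
Qed.

(** * Right angles and orthogonal projections in terms of the form *)

(** The pole of [l] lies on [m], so it is spanned by some x b + y c. Its orthogonality to b and a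
    gives x f(b,b) + y f(b,c) = 0 and x f(a,b) + y f(a,c) = 0; a nonzero solution (x,y) makes the
    determinant vanish. *)
Lemma pperp_form l m A B C : A <> B -> B <> C ->
  pon A l -> pon B l -> pon B m -> pon C m -> pperp f l m ->
  f (vec A) (vec B) * f (vec B) (vec C) = f (vec B) (vec B) * f (vec A) (vec C).
Proof.
move=> AB BC Al Bl Bm Cm [/subvP lm _].
have [n n0 nl] := pline_pole Al Bl AB.
have [x [y e]] := pline_span_points Bm Cm BC (lm _ nl).
move/mem_orthovP: nl => nl.
have := nl _ (proj1 (ponE _ _) Al); have := nl _ (proj1 (ponE _ _) Bl).
move: n0; rewrite {}e {nl} !formE.
rewrite (formC (vec C) (vec B)) (formC (vec B) (vec A)) (formC (vec C) (vec A)).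
set a := vec A; set b := vec B; set c := vec C => n0 h1 h2.
(* If y = 0, the pole is B itself, f(b,b) = f(a,b) = 0, and both sides vanish. *)
have [y0|y0] := eqVneq y 0.
  have x0 : x != 0 by apply: contraNneq n0 => ->; rewrite y0 !scale0r addr0.
  move: h1 h2; rewrite y0 !mul0r !addr0 => /eqP; rewrite mulf_eq0 (negPf x0) /= => /eqP ->.
  by move=> /eqP; rewrite mulf_eq0 (negPf x0) /= => /eqP ->; rewrite !mul0r.
apply: (mulfI y0).
transitivity (f a b * (y * f b c)); first by ring.
transitivity (f b b * (y * f a c)); last by ring.
rewrite (_ : y * f b c = - (x * f b b)); last by apply/eqP; rewrite -addr_eq0 addrC h1.
rewrite (_ : y * f a c = - (x * f a b)); last by apply/eqP; rewrite -addr_eq0 addrC h2.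
by ring.
Qed.

(** The restriction of [f] to the plane [val l] has trivial radical: the line does not meet its own
    pole. *)
Definition nondegenerate_on l : Prop :=
  forall u, u \in val l -> u \in orthov f (val l) -> u = 0.

(** The line [m] joins X to the pole n of [p], so a = k x + j n, and pairing with vectors of [p]
    kills n. If k were 0, A would be the pole. *)
Lemma projection_form A p m X : nondegenerate_on p -> ~ is_pole f A p ->
  pon A m -> pperp f p m -> pon X p -> pon X m ->
  (exists P Q, [/\ P <> Q, pon P p & pon Q p]) ->
  exists2 k, k != 0 & forall v, v \in val p -> f (vec A) v = k * f (vec X) v.
Proof.
move=> nd npole /ponE Am [/subvP pm _] /ponE Xp /ponE Xm [P [Q [PQ Pp Qp]]].
have [n n0 np] := pline_pole Pp Qp PQ.
have nXn k : n <> k *: vec X.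
  move=> e; move/eqP: n0; apply; apply: (nd n) => //.
  by rewrite e memvZ.
have [k [j e]] := pline_span Xm (pm _ np) (vec_neq0 X) nXn Am.
exists k; last first.
  by move=> v vp; rewrite e !formE (mem_orthovP np) // mulr0 addr0.
apply/negP => /eqP k0; apply: npole; rewrite /is_pole; apply/eqP.
have An : vec A \in orthov f (val p) by rewrite e k0 scale0r add0r memvZ.
rewrite eqEdim {1}ppointE -memvE An (eqP (valP A)) /=.
(* Nondegeneracy bounds the dimension of the orthogonal of [p] by 1, so the vector of A in it spans
   it. *)
have cap0 : (val p :&: orthov f (val p))%VS = 0%VS.
  apply/eqP; rewrite -subv0; apply/subvP => x; rewrite memv_cap => /andP[xp xo].
  by rewrite memv0 (nd x).
have := dimv_disjoint_sum cap0; rewrite (eqP (valP p)) => h.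
have := dimvS (subvf (val p + orthov f (val p))%VS).
by rewrite h dimvf.
Qed.

(** * The reflection of a line in a midpoint *)

Lemma orthogonal_basis_anisotropic l u v : nondegenerate_on l ->
  u \in val l -> u != 0 -> f u v = 0 ->
  (forall z, z \in val l -> exists x y, z = x *: u + y *: v) ->
  f u u != 0.
Proof.
move=> nd ul u0 uv span; apply/eqP => uu; move/eqP: u0; apply.
apply: (nd u) => //; apply/mem_orthovP => z /span[x [y ->]].
by rewrite !formE uu uv !mulr0 addr0.
Qed.

(** The two sides of the assumed equation differ by 2 (a1 c2 + a2 c1) f(u,u) f(v,v). *)
Lemma reflected_coordinates u v a1 a2 c1 c2 : f u v = 0 ->
  f u u != 0 -> f v v != 0 ->
  let a := a1 *: u + a2 *: v in let c := c1 *: u + c2 *: v in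
  f a (u + v) * f (u + v) c = f a (u - v) * f (u - v) c ->
  a1 * c2 = - (a2 * c1).
Proof.
move=> uv uu vv a c; rewrite /a /c -scaleN1r !formE (formC v u) uv => e.
apply: (mulfI uu); apply: (mulfI vv); lra.
Qed.

(** Equidistance is stated squared and without denominators, hence independently of the chosen
    spanning vectors. [K] is the constant common to the right angles at B and D. *)
Lemma midpoint_form l B D M P Q K : nondegenerate_on l -> B <> D ->
  pon B l -> pon D l -> pon M l -> pon P l -> pon Q l ->
  0 < f (vec B) (vec B) * f (vec D) (vec D) ->
  f (vec M) (vec B) ^+ 2 * f (vec D) (vec D) =
  f (vec M) (vec D) ^+ 2 * f (vec B) (vec B) ->
  f (vec P) (vec B) * f (vec B) (vec Q) = f (vec B) (vec B) * K ->
  f (vec P) (vec D) * f (vec D) (vec Q) = f (vec D) (vec D) * K ->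
  f (vec M) (vec P) ^+ 2 * f (vec Q) (vec Q) =
  f (vec M) (vec Q) ^+ 2 * f (vec P) (vec P) /\
  (P = Q -> M = P \/ f (vec M) (vec P) = 0).
Proof.
move=> nd BD Bl Dl /ponE + /ponE + /ponE +.
set b := vec B; set d := vec D; set m := vec M; set p := vec P; set q := vec Q.
move=> Ml Pl Ql bd0 mid hB hD.
have span := pline_span_points Bl Dl BD; rewrite -/b -/d in span.
have d0 : f d d != 0 by apply: contraTneq bd0 => ->; rewrite mulr0 ltxx.
have b0 : f b b != 0 by apply: contraTneq bd0 => ->; rewrite mul0r ltxx.
(* The vector t d is the normalised d. The size of t comes from f(d,d), and its sign is chosen
   according to M. *)
have [t [t0 td tm]] : exists t, [/\ t != 0, t ^+ 2 * f d d = f b b & f m b = t * f m d].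
  set s := Num.sqrt (f b b / f d d).
  have r0 : 0 < f b b / f d d.
    rewrite (_ : _ / _ = (f b b * f d d) / (f d d ^+ 2)); last by field.
    by rewrite divr_gt0 // exprn_even_gt0.
  have s2 : s ^+ 2 * f d d = f b b by rewrite sqr_sqrtr ?ltW // divfK.
  have s0 : s != 0 by rewrite gt_eqF // sqrtr_gt0.
  have : f m b ^+ 2 == (s * f m d) ^+ 2.
    apply/eqP/(mulIf d0); rewrite mid exprMn -s2; ring.
  rewrite eqf_sqr => /orP[/eqP e|/eqP e]; first by exists s.
  by exists (- s); rewrite oppr_eq0 sqrrN mulNr.
(* The vectors [u] and [v] are made opaque, so that expanding the form keeps them as a basis. *)
have [u uE] : {u | u = b + t *: d} by exists (b + t *: d).
have [v vE] : {v | v = b - t *: d} by exists (b - t *: d).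
have indep x y : x *: b + y *: d = 0 -> x = 0 /\ y = 0.
  have [-> e|x0 e] := eqVneq x 0.
    split=> //; move/eqP: e; rewrite scale0r add0r scaler_eq0 => /orP[/eqP //|].
    by rewrite (negPf (vec_neq0 D)).
  case: BD; apply: (@ppoint_eq _ _ (- (x^-1 * y))).
  apply/eqP; rewrite -subr_eq0 scaleNr opprK -scalerA -[vec B](scalerK x0).
  by rewrite -scalerDr e scaler0.
have bl : b \in val l by apply/ponE.
have dl : d \in val l by apply/ponE.
have ul : u \in val l by rewrite uE memvD // memvZ.
have vl : v \in val l by rewrite vE memvB // memvZ.
have u0 : u != 0.
  apply/eqP => e; have [] : 1 = 0 :> R /\ t = 0 by apply: indep; rewrite scale1r -uE.
  by move/eqP; rewrite oner_eq0.
have v0 : v != 0.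
  apply/eqP => e; have [] : 1 = 0 :> R /\ - t = 0.
    by apply: indep; rewrite scale1r scaleNr -vE.
  by move/eqP; rewrite oner_eq0.
have uv : f u v = 0.
  rewrite uE vE -scaleNr !formE (formC d b); move: td => <-; ring.
have span' w : w \in val l -> exists x y, w = x *: u + y *: v.
  move=> /span[x [y ->]]; exists (2^-1 * (x + t^-1 * y)), (2^-1 * (x - t^-1 * y)).
  rewrite uE vE !scalerDr !scalerN !scalerA addrACA -scalerDl -scalerBl.
  by congr (_ *: _ + _ *: _); field.
have uu : f u u != 0 by apply: orthogonal_basis_anisotropic span'.
have vv : f v v != 0.
  apply: (@orthogonal_basis_anisotropic l v u) => //; first by rewrite formC.
  by move=> w /span'[x [y ->]]; exists y, x; rewrite addrC.
have [x [y em]] := span' _ Ml.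
(* By the choice of t, f(m,v) = 0, so m is a multiple of u. *)
have y0 : y = 0.
  have : f m v = 0 by rewrite vE -scaleNr !formE tm; ring.
  rewrite em !formE uv mulr0 add0r => /eqP; rewrite mulf_eq0 (negPf vv) orbF.
  by move/eqP.
rewrite {y} y0 scale0r addr0 in em.
have [p1 [p2 ep]] := span' _ Pl; have [q1 [q2 eq]] := span' _ Ql.
have x0 : x != 0 by apply: contraNneq (vec_neq0 M) => x0; rewrite -/m em x0 scale0r.
(* Since u + v = 2 b and u - v = 2 t d, the identities at B and D, with the same [K] and t^2 f(d,d)
   = f(b,b), are what the coordinate lemma requires. *)
have refl : p1 * q2 = - (p2 * q1).
  apply: reflected_coordinates uv uu vv _ => /=; rewrite -ep -eq.
  have -> : u + v = 2 *: b by rewrite uE vE addrACA subrr addr0 scaler_nat mulr2n.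
  have -> : u - v = (2 * t) *: d.
    by rewrite uE vE opprB addrC addrA subrK -scalerA scaler_nat mulr2n.
  rewrite !formE.
  transitivity (4 * (f p b * f b q)); first by ring.
  transitivity (4 * t ^+ 2 * (f p d * f d q)); last by ring.
  by rewrite hB hD -td; ring.
split.
  rewrite em ep eq !formE (formC v u) uv.
  apply/eqP; rewrite -subr_eq0; apply/eqP.
  transitivity (x ^+ 2 * f u u ^+ 2 * f v v * ((p1 * q2) ^+ 2 - (p2 * q1) ^+ 2)).
    by ring.
  by rewrite refl sqrrN subrr mulr0.
move=> PQ; have epq : p = q by rewrite /p /q PQ.
(* When P = Q the relation reads p1 p2 = - p1 p2. Then p is proportional to v, which is conjugate to
   M, or to u, which spans M. *)
have : p1 * p2 = 0.
  have h1 : q1 = p1.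
    have : f p u = f q u by rewrite epq.
    by rewrite ep eq !formE (formC v u) uv !mulr0 !addr0 => /(mulIf uu).
  have h2 : q2 = p2.
    have : f p v = f q v by rewrite epq.
    by rewrite ep eq !formE uv !mulr0 !add0r => /(mulIf vv).
  move: refl; rewrite h1 h2 (mulrC p2) => /eqP.
  by rewrite -addr_eq0 -mulr2n mulrn_eq0 => /eqP.
move=> /eqP; rewrite mulf_eq0 => /orP[/eqP h|/eqP h].
  by right; rewrite em ep h !formE uv; ring.
have p0 : p1 != 0.
  by apply: contraNneq (vec_neq0 P) => h'; rewrite -/p ep h h' !scale0r addr0.
left; apply: (@ppoint_eq _ _ (x / p1)).
by rewrite -/m -/p em ep h scale0r addr0 scalerA divfK.
Qed.

(** * Equidistance in the projective models *)

Lemma ck_cos_sq P Q : 0 < f (vec P) (vec P) * f (vec Q) (vec Q) ->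
  ck_cos f P Q ^+ 2 = f (vec P) (vec Q) ^+ 2 / (f (vec P) (vec P) * f (vec Q) (vec Q)).
Proof.
by move=> pq; rewrite /ck_cos expr_div_n real_normK ?num_real // sqr_sqrtr ?ltW.
Qed.

Lemma ck_cos_ge0 P Q : 0 <= ck_cos f P Q.
Proof. by rewrite divr_ge0 // sqrtr_ge0. Qed.

(** Squaring is injective on nonnegative numbers, and the common factor f(m,m) cancels. *)
Lemma eq_ck_cos M P Q :
  0 < f (vec M) (vec M) * f (vec P) (vec P) ->
  0 < f (vec M) (vec M) * f (vec Q) (vec Q) ->
  ck_cos f M P = ck_cos f M Q <->
  f (vec M) (vec P) ^+ 2 * f (vec Q) (vec Q) =
  f (vec M) (vec Q) ^+ 2 * f (vec P) (vec P).
Proof.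
move=> mp mq.
have m0 : f (vec M) (vec M) != 0 by apply: contraTneq mp => ->; rewrite mul0r ltxx.
have p0 : f (vec P) (vec P) != 0 by apply: contraTneq mp => ->; rewrite mulr0 ltxx.
have q0 : f (vec Q) (vec Q) != 0 by apply: contraTneq mq => ->; rewrite mulr0 ltxx.
split=> [/(congr1 (fun z => z ^+ 2))|e]; last first.
  apply: (pexpIrn (isT : 0 < 2)%N); rewrite ?nnegrE ?ck_cos_ge0 //.
  rewrite !ck_cos_sq //; apply/eqP; rewrite eqr_div ?mulf_neq0 //; apply/eqP.
  by rewrite mulrCA e; ring.
rewrite !ck_cos_sq // => e.
transitivity ((f (vec M) (vec P) ^+ 2 / (f (vec M) (vec M) * f (vec P) (vec P)))
    * (f (vec M) (vec M) * f (vec P) (vec P) * f (vec Q) (vec Q))).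
  by field; rewrite m0 p0.
by rewrite e; field; rewrite m0 q0.
Qed.

(** The argument common to the hyperbolic and elliptic planes, which differ only in how the
    nondegeneracy, pole and sign conditions are obtained. *)
Lemma ck_midpoint (l : pline R) A B C D M P Q :
  nondegenerate_on l -> ~ is_pole f A l -> ~ is_pole f C l ->
  [/\ A <> B, B <> C, A <> D, C <> D & B <> D] ->
  (exists l1 l2, [/\ pon A l1, pon B l1, pon B l2, pon C l2 & pperp f l1 l2]) ->
  (exists l1 l2, [/\ pon A l1, pon D l1, pon D l2, pon C l2 & pperp f l1 l2]) ->
  (exists m, [/\ pon A m, pperp f l m, pon P l & pon P m]) ->
  (exists m, [/\ pon C m, pperp f l m, pon Q l & pon Q m]) ->
  pon B l -> pon D l -> pon M l ->
  [/\ 0 < f (vec B) (vec B) * f (vec D) (vec D),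
      0 < f (vec M) (vec M) * f (vec B) (vec B),
      0 < f (vec M) (vec M) * f (vec D) (vec D),
      0 < f (vec M) (vec M) * f (vec P) (vec P)
    & 0 < f (vec M) (vec M) * f (vec Q) (vec Q)] ->
  ck_cos f M B = ck_cos f M D ->
  ck_cos f M P = ck_cos f M Q /\ (P = Q -> M = P \/ pconjugate f P M).
Proof.
move=> nd Al Cl [AB BC AD CD BD] [l1 [l2 [Al1 Bl1 Bl2 Cl2 l12]]].
move=> [l3 [l4 [Al3 Dl3 Dl4 Cl4 l34]]] [m1 [Am1 pm1 Pl Pm1]] [m2 [Cm2 pm2 Ql Qm2]].
move=> Bl Dl Ml [posBD posMB posMD posMP posMQ] mid.
have hB := pperp_form AB BC Al1 Bl1 Bl2 Cl2 l12.
have hD := pperp_form AD (fun e => CD (esym e)) Al3 Dl3 Dl4 Cl4 l34.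
have two : exists P Q, [/\ P <> Q, pon P l & pon Q l] by exists B, D.
have [k k0 kE] := projection_form nd Al Am1 pm1 Pl Pm1 two.
have [j j0 jE] := projection_form nd Cl Cm2 pm2 Ql Qm2 two.
have mB := proj1 (ponE _ _) Bl; have mD := proj1 (ponE _ _) Dl.
(* The factors k and j are the same against b and d, which gives one constant for both right
   angles. *)
have := @midpoint_form l B D M P Q (f (vec A) (vec C) / (k * j)) nd BD Bl Dl Ml Pl Ql.
case.
- exact: posBD.
- exact/eq_ck_cos.
- by apply: gram_rescale hB; rewrite // 1?(formC _ (vec C)) ?kE ?jE // (formC (vec Q)).
- by apply: gram_rescale hD; rewrite // 1?(formC _ (vec C)) ?kE ?jE // (formC (vec Q)).
move=> h1 h2; split; first exact/eq_ck_cos.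
move=> /h2[|h]; [by left|right].
exact/pconjugateE.
Qed.

(** * Signs and Cauchy-Schwarz for anisotropic forms *)

Lemma form_sub_proj u v : f u u != 0 ->
  f (v - (f v u / f u u) *: u) u = 0.
Proof. by move=> u0; rewrite -scaleNr !formE mulNr divfK // subrr. Qed.

(** Otherwise the quadratic polynomial f(v + t u, v + t u) in t has a nonnegative discriminant, and
    its real root gives an isotropic vector. *)
Lemma anisotropic_lt u v : f u u != 0 ->
  (forall t, v + t *: u != 0 -> f (v + t *: u) (v + t *: u) != 0) ->
  (forall t, v + t *: u != 0) -> f v u ^+ 2 < f v v * f u u.
Proof.
move=> u0 aniso indep; rewrite ltNge; apply/negP => le.
have := aniso ((- f v u + Num.sqrt (f v u ^+ 2 - f v v * f u u)) / f u u) (indep _).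
set r := Num.sqrt _; have r2 : r ^+ 2 = f v u ^+ 2 - f v v * f u u.
  by rewrite sqr_sqrtr // subr_ge0.
case/eqP; rewrite !formE (formC u v).
transitivity ((f v v * f u u - f v u ^+ 2 + r ^+ 2) / f u u); first by field.
by rewrite r2; field.
Qed.

Lemma anisotropic_cauchy_schwarz u v : f u u != 0 ->
  (forall x y, x *: u + y *: v != 0 ->
     f (x *: u + y *: v) (x *: u + y *: v) != 0) ->
  f v u ^+ 2 <= f v v * f u u.
Proof.
move=> u0 aniso.
have [indep|/existsNP[t /negP]] := pselect (forall t, v + t *: u != 0).
  apply/ltW/anisotropic_lt => // t h.
  by have := aniso t 1; rewrite scale1r addrC; apply.
rewrite negbK addr_eq0 => /eqP ->.
by rewrite -scaleNr !formE le_eqVlt; apply/orP; left; apply/eqP; ring.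
Qed.

(** By Cauchy-Schwarz the product is at least the square f(v,u)^2. *)
Lemma anisotropic_same_sign u v : f u u != 0 -> f v v != 0 ->
  (forall x y, x *: u + y *: v != 0 ->
     f (x *: u + y *: v) (x *: u + y *: v) != 0) ->
  0 < f u u * f v v.
Proof.
move=> u0 v0 aniso; rewrite lt_def mulf_neq0 //= mulrC.
by apply: le_trans (anisotropic_cauchy_schwarz u0 aniso); exact: sqr_ge0.
Qed.

Lemma ppoint_conic v : v != 0 -> f v v = 0 ->
  exists2 T, on_conic f T & vec T \in <[v]>%VS.
Proof.
move=> v0 vv; have [T [k k0 e]] := ppoint_of_vec v0.
exists T; last by rewrite e memvZ ?memv_line.
move=> w; rewrite ppointE => /vlineP[t ->].
by rewrite e !formE vv !mulr0.
Qed.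

(** * Interior points of a conic *)

Section Interior.
Implicit Types (T : ppoint R).

(** A point of the conic lies on its own tangent. *)
Lemma interior_anisotropic P : interior_point f P -> f (vec P) (vec P) != 0.
Proof.
move=> intP; apply/eqP => PP; apply: (intP P).
  by move=> w; rewrite ppointE => /vlineP[t ->]; rewrite !formE PP !mulr0.
exact/pconjugateE.
Qed.

(** An isotropic v would span a point of the conic whose tangent passes through P. *)
Lemma interior_orthogonal_anisotropic P v : interior_point f P ->
  v != 0 -> f v (vec P) = 0 -> f v v != 0.
Proof.
move=> intP v0 vP; apply/eqP => vv.
have [T Tc /vlineP[k e]] := ppoint_conic v0 vv.
apply: (intP T) => //; apply/pconjugateE; rewrite e formC.
by rewrite formZl vP mulr0.
Qed.

(* The form is anisotropic, hence definite, on the polar of [P]; the isotropic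
   vector [c] forces its sign there to be opposite to that at [P]. *)
Lemma interior_orthogonal_sign P c v : interior_point f P ->
  c != 0 -> f c c = 0 -> v != 0 -> f v (vec P) = 0 ->
  f (vec P) (vec P) * f v v < 0.
Proof.
move=> intP c0 cc v0 vP; set p := vec P in vP *.
have pp : f p p != 0 := interior_anisotropic intP.
(* Here w is the component of c orthogonal to p; f(c,c) = 0 turns into f(w,w) = - k^2 f(p,p). *)
pose k := f c p / f p p; have [w wE] : {w | w = c - k *: p} by eexists.
have wp : f w p = 0 by rewrite wE form_sub_proj.
have cE : c = w + k *: p by rewrite wE subrK.
have pw : f w w = - (k ^+ 2 * f p p).
  apply/eqP; rewrite -addr_eq0 -cc; apply/eqP.
  by rewrite [in RHS]cE !formE (formC p w) wp; ring.
have w0 : w != 0.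
  apply: contraNneq c0 => w0; rewrite cE w0 add0r.
  move/eqP: pw; rewrite w0 -(scale0r p) formZl mul0r eq_sym oppr_eq0.
  by rewrite mulf_eq0 (negPf pp) orbF sqrf_eq0 => /eqP ->; rewrite scale0r.
have ww := interior_orthogonal_anisotropic intP w0 wp.
have vv := interior_orthogonal_anisotropic intP v0 vP.
have same : 0 < f w w * f v v.
  apply: anisotropic_same_sign => // x y h.
  by apply: (interior_orthogonal_anisotropic intP h); rewrite !formE wp vP !mulr0 addr0.
have k0 : k != 0 by apply: contraNneq ww => k0; rewrite pw k0 expr0n mul0r oppr0.
have k2 : 0 < k ^+ 2 by rewrite exprn_even_gt0.
rewrite -oppr_gt0 -(pmulr_rgt0 _ k2); move: same; rewrite pw; congr (0 < _); ring.
Qed.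

(** A real point of the conic: without one, every point is vacuously interior and the form may be
    definite. *)
Variable hc : exists2 c, c != 0 & f c c = 0.

(** A vector n orthogonal to both points has f(n,n) of sign opposite to each. *)
Lemma interior_same_sign P Q : interior_point f P -> interior_point f Q ->
  0 < f (vec P) (vec P) * f (vec Q) (vec Q).
Proof.
move=> intP intQ; have [c c0 cc] := hc.
have [n [n0 nP nQ]] := exists_orthogonal (vec P) (vec Q).
have hP := interior_orthogonal_sign intP c0 cc n0 nP.
have hQ := interior_orthogonal_sign intQ c0 cc n0 nQ.
have nn : f n n != 0 by apply: contraTneq hP => ->; rewrite mulr0 ltxx.
have n2 : 0 < f n n ^+ 2 by rewrite exprn_even_gt0.
have : 0 < (f (vec P) (vec P) * f n n) * (f (vec Q) (vec Q) * f n n).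
  by rewrite nmulr_rgt0.
by rewrite mulrACA -expr2 pmulr_lgt0.
Qed.

Lemma interior_not_orthogonal P Q : interior_point f P -> interior_point f Q ->
  f (vec P) (vec Q) != 0.
Proof.
move=> intP intQ; apply/eqP => PQ; have [c c0 cc] := hc.
have := interior_orthogonal_sign intQ c0 cc (vec_neq0 P) PQ.
by rewrite ltNge ltW // interior_same_sign.
Qed.

(** With w the component of v orthogonal to p, left side minus right side is f(p,p) f(w,w), which is
    not positive. *)
Lemma interior_reverse_cauchy_schwarz P v : interior_point f P ->
  f (vec P) (vec P) * f v v <= f (vec P) v ^+ 2.
Proof.
move=> intP; have [c c0 cc] := hc; set p := vec P.
have pp : f p p != 0 := interior_anisotropic intP.
pose w := v - (f v p / f p p) *: p.
have wp : f w p = 0 by apply: form_sub_proj.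
have le0 : f p p * f w w <= 0.
  have [->|w0] := eqVneq w 0; first by rewrite -(scale0r p) formZl mul0r mulr0.
  by apply/ltW/(interior_orthogonal_sign intP c0 cc).
rewrite -subr_le0 (_ : _ - _ = f p p * f w w) //.
by rewrite /w -scaleNr !formE (formC p v); field.
Qed.

Lemma interior_nondegenerate l P : interior_point f P -> pon P l ->
  nondegenerate_on l.
Proof.
move=> intP /ponE Pl u ul /mem_orthovP uo; apply/eqP/negP => /negP u0.
have := interior_orthogonal_anisotropic intP u0 (uo _ Pl).
by rewrite uo ?eqxx.
Qed.

Lemma ck_cos_ge1 P Q : interior_point f P -> interior_point f Q ->
  1 <= ck_cos f P Q.
Proof.
move=> intP intQ; rewrite -(@ler_pXn2r _ 2) ?nnegrE ?ck_cos_ge0 //.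
rewrite expr1n ck_cos_sq ?interior_same_sign // ler_pdivlMr ?interior_same_sign //.
by rewrite mul1r interior_reverse_cauchy_schwarz.
Qed.

End Interior.

(** * Forms without isotropic vectors, as for an imaginary conic *)

Section Anisotropic.
Hypothesis aniso : forall v, v != 0 -> f v v != 0.

Lemma anisotropic_pos u v : u != 0 -> v != 0 -> 0 < f u u * f v v.
Proof. by move=> u0 v0; apply: anisotropic_same_sign; auto. Qed.

Lemma anisotropic_nondegenerate l : nondegenerate_on l.
Proof.
move=> u ul /mem_orthovP uo; apply/eqP/negP => /negP /aniso.
by rewrite uo ?eqxx.
Qed.

Lemma ck_cos_le1 P Q : ck_cos f P Q <= 1.
Proof.
have pos := anisotropic_pos (vec_neq0 P) (vec_neq0 Q).
rewrite -(@ler_pXn2r _ 2) ?nnegrE ?ck_cos_ge0 //.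
rewrite expr1n ck_cos_sq // ler_pdivrMr // mul1r.
by rewrite (mulrC (f _ _)) (formC (vec P)) anisotropic_cauchy_schwarz ?aniso ?vec_neq0; auto.
Qed.

End Anisotropic.

End Form.

(** * Recovering [ck_cos] from the distance *)

Section Arc.
Variable R : realType.

(** On [1, oo) the argument of the logarithm is positive and strictly increasing. *)
Lemma arcosh_inj (x y : R) : 1 <= x -> 1 <= y -> arcosh x = arcosh y -> x = y.
Proof.
have mono (a b : R) : 1 <= a -> a < b ->
    a + Num.sqrt (a ^+ 2 - 1) < b + Num.sqrt (b ^+ 2 - 1).
  move=> a1 ab; apply: ltr_leD => //; rewrite ler_wsqrtr // lerD2r.
  by rewrite ler_pXn2r ?nnegrE //; lra.
have pos (a : R) : 1 <= a -> a + Num.sqrt (a ^+ 2 - 1) \is Num.pos.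
  by move=> a1; rewrite posrE ltr_wpDr ?sqrtr_ge0 //; lra.
move=> x1 y1 /ln_inj e; have {}e := e (pos _ x1) (pos _ y1).
by case: (ltgtP x y) => // [/(mono _ _ x1)|/(mono _ _ y1)]; rewrite e ltxx.
Qed.

Lemma acos_inj : {in `[0, 1] &, injective (@acos R)}.
Proof.
have sub (x : R) : x \in `[0, 1] -> x \in `[-1, 1].
  by rewrite !in_itv /= => /andP[? ?]; apply/andP; split; lra.
by move=> x y /sub hx /sub hy e; rewrite -(acosK hx) e acosK.
Qed.

End Arc.

(** * The theorem in each of the three planes *)

Lemma diametral_midpoint_euclidean (R : realType)
    (A B C D A' C' M : point_of (Euclidean R))
    (bd : line_of (Euclidean R)) :
  diametral A B C D -> incident B bd -> incident D bd ->
  orthogonal_projection A bd A' -> orthogonal_projection C bd C' ->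
  midpoint bd B D M -> midpoint bd A' C' M.
Proof.
move=> [[_ [_ BD _] _] rB rD] hB hD [_ [m1 [Am1 pm1 A'l A'm1]]].
move=> [_ [m2 [Cm2 pm2 C'l C'm2]]] [_ _ Ml /(_ BD) mid _].
have right (P Q X : 'rV[R]_2) : @right_angle R (Euclidean R) P Q X ->
    dotp (P - Q) (X - Q) = 0.
  move=> [l [m [Pl Ql Qm Xm lm]]].
  have [s ->] := eon_sub Pl Ql; have [t ->] := eon_sub Xm Qm.
  by rewrite dotpZl dotpZr lm !mulr0.
have hrB := right _ _ _ rB; have hrD := right _ _ _ rD.
set u := edir bd in pm1 pm2.
have hA : dotp A u = dotp A' u.
  have [s e] := eon_sub Am1 A'm1.
  by rewrite -[A in LHS](subrK A') e dotpDl dotpZl dotpC pm1 mulr0 add0r.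
have hC : dotp C u = dotp C' u.
  have [s e] := eon_sub Cm2 C'm2.
  by rewrite -[C in LHS](subrK C') e dotpDl dotpZl dotpC pm2 mulr0 add0r.
have uu : dotp u u != 0 by rewrite gt_eqF // dotp_gt0 // edir_neq0.
move: hB hD Ml A'l C'l; rewrite /incident.
move=> [b bE] [d dE] [m mE] [a aE] [c cE].
set o := eorigin bd in bE dE mE aE cE; rewrite -/u in bE dE mE aE cE.
have bd0 : b - d != 0 by rewrite subr_eq0; apply: contra_not_neq BD => e; rewrite bE dE e.
have dot x y : dotp ((o + x *: u) - (o + y *: u)) ((o + x *: u) - (o + y *: u)) =
    (x - y) ^+ 2 * dotp u u.
  by rewrite opprD addrACA subrr add0r -scalerBl dotpZl dotpZr; ring.
(* From (m - b)^2 = (m - d)^2, after division by b - d. *)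
have mbd : 2 * m = b + d.
  have : (m - b) ^+ 2 = (m - d) ^+ 2.
    apply: (mulIf uu); rewrite -!dot -mE -bE -dE.
    rewrite -[LHS]sqr_sqrtr ?dotp_ge0 // -[RHS]sqr_sqrtr ?dotp_ge0 //.
    by congr (_ ^+ 2).
  by move=> e; apply: (mulfI bd0); lra.
(* The difference of the two right-angle equations is (b - d) (a + c - b - d) times f(u,u) up to
   sign, where f is the scalar product; A and C enter only through their products with u, which are
   those of A' and C'. *)
have acbd : a + c = b + d.
  apply: (mulfI bd0); apply: (mulIf uu).
  move: hrB hrD hA hC; rewrite bE dE -!scaleN1r !(dotpDl, dotpDr, dotpZl, dotpZr).
  rewrite (dotpC u C) (dotpC u o) (dotpC o C) => h1 h2.
  rewrite aE cE !(dotpDl, dotpZl) => hA hC; rewrite hA hC in h1 h2.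
  lra.
split=> //; first by exists a.
- by exists c.
- by exists m.
- move=> _; rewrite /dist /edist mE aE cE !dot; congr (Num.sqrt (_ * _)).
  have -> : c = 2 * m - a by rewrite mbd -acbd; ring.
  by ring.
move=> ac; left; rewrite mE aE; congr (_ + _ *: _).
have : (a - c) ^+ 2 * dotp u u = 0.
  by rewrite -dot -aE -cE ac subrr -(scale0r u) dotpZl mul0r.
by move/eqP; rewrite mulf_eq0 (negPf uu) orbF sqrf_eq0 => /eqP; lra.
Qed.

Lemma diametral_midpoint_elliptic (R : realType) (phi : imaginary_conic R)
    (A B C D A' C' M : point_of (Elliptic phi)) (bd : line_of (Elliptic phi)) :
  diametral A B C D -> incident B bd -> incident D bd ->
  orthogonal_projection A bd A' -> orthogonal_projection C bd C' ->
  midpoint bd B D M -> midpoint bd A' C' M.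
Proof.
move=> [[[AB _ AD] [BC BD CD] _] rB rD] hB hD [Apole hA'] [Cpole hC'].
move=> [_ _ Ml /(_ BD) mid _].
(* An isotropic vector would span a real point of the imaginary conic. *)
have aniso v : v != 0 -> phi v v != 0.
  move=> v0; apply/eqP => vv; have [T Tc _] := ppoint_conic v0 vv.
  by apply: (@imag_no_points _ phi); exists T.
have pos (P Q : ppoint R) : 0 < phi (vec P) (vec P) * phi (vec Q) (vec Q).
  exact: (anisotropic_pos aniso (vec_neq0 P) (vec_neq0 Q)).
have ck01 (P Q : ppoint R) : ck_cos phi P Q \in `[0, 1].
  by rewrite in_itv /= ck_cos_ge0 ck_cos_le1.
have [m1 [_ _ A'l _]] := hA'; have [m2 [_ _ C'l _]] := hC'.
have := @ck_midpoint R phi bd A B C D M A' C' (anisotropic_nondegenerate aniso (l := bd))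
  Apole Cpole (And5 AB BC AD CD BD) rB rD hA' hC' hB hD Ml
  (And5 (pos _ _) (pos _ _) (pos _ _) (pos _ _) (pos _ _))
  (acos_inj (ck01 _ _) (ck01 _ _) mid).
move=> [eq0 eq1]; split=> // _.
by rewrite /dist eq0.
Qed.

Lemma diametral_midpoint_hyperbolic (R : realType) (phi : real_conic R)
    (A B C D A' C' M : point_of (Hyperbolic phi)) (bd : line_of (Hyperbolic phi)) :
  diametral A B C D -> incident B bd -> incident D bd ->
  orthogonal_projection A bd A' -> orthogonal_projection C bd C' ->
  midpoint bd B D M -> midpoint bd A' C' M.
Proof.
move=> [[[AB _ AD] [BC BD CD] _] rB rD] hB hD [_ hA'] [_ hC'] [_ _ Ml /(_ BD) mid _].
have int (P : point_of (Hyperbolic phi)) : interior_point phi (val P).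
  by have /asboolP := valP P.
have neq (P Q : point_of (Hyperbolic phi)) : P <> Q -> val P <> val Q.
  by move=> PQ /val_inj.
have hc : exists2 c, c != 0 & phi c c = 0.
  have [T Tc] := real_points phi; exists (vec T); first exact: vec_neq0.
  by apply: Tc; apply: memv_pick.
(* The pole of [bd] is orthogonal to B, but two interior points are never orthogonal. *)
have npole (P : point_of (Hyperbolic phi)) : ~ is_pole phi (val P) bd.
  move=> e; have /eqP := interior_not_orthogonal hc (int P) (int B); apply.
  by apply: (mem_orthovP (V := val bd)); [rewrite -e memv_pick | apply/ponE].
have pos (P Q : point_of (Hyperbolic phi)) :
    0 < phi (vec (val P)) (vec (val P)) * phi (vec (val Q)) (vec (val Q)).
  exact: interior_same_sign.
have ck1 (P Q : point_of (Hyperbolic phi)) :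
  1 <= ck_cos phi (val P) (val Q) by apply: ck_cos_ge1.
have [m1 [_ _ A'l _]] := hA'; have [m2 [_ _ C'l _]] := hC'.
have := @ck_midpoint R phi bd (val A) (val B) (val C) (val D) (val M) (val A') (val C')
  (interior_nondegenerate (int B) hB) (npole A) (npole C)
  (And5 (neq _ _ AB) (neq _ _ BC) (neq _ _ AD) (neq _ _ CD) (neq _ _ BD))
  rB rD hA' hC' hB hD Ml
  (And5 (pos _ _) (pos _ _) (pos _ _) (pos _ _) (pos _ _))
  (arcosh_inj (ck1 _ _) (ck1 _ _) mid).
move=> [eq0 eq1]; split=> //; first by move=> _; rewrite /dist eq0.
(* The conjugate alternative is excluded, because M and A' are both interior. *)
move=> /(congr1 val) /eq1[/val_inj|]; [by left|].
move=> /pconjugateE MA.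
by have := interior_not_orthogonal hc (int M) (int A'); rewrite MA eqxx.
Qed.

Theorem theorem1 (R : realType) (G : plane R) (A B C D A' C' M : point_of G)
    (bd : line_of G)
    (hR : diametral A B C D)
    (hB : incident B bd) (hD : incident D bd)
    (hA' : orthogonal_projection A bd A')
    (hC' : orthogonal_projection C bd C')
    (hM : midpoint bd B D M) :
  midpoint bd A' C' M.
Proof.
case: G A B C D A' C' M bd hR hB hD hA' hC' hM => [|phi|phi] A B C D A' C' M bd.
- exact: diametral_midpoint_euclidean.
- exact: diametral_midpoint_hyperbolic.
- exact: diametral_midpoint_elliptic.
Qed.
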